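(* Let $s,t>0$. The generator $\mathcal L$ and the operator $K_1^++K_2^+$ commute, i.e. for all $f:\mathbb N^2\to\mathbb R$, $$\mathcal L\,(K_1^++K_2^+)f=(K_1^++K_2^+)\,\mathcal L f.$$
   Context: $\mathbb N=\{0,1,2,\dots\}$; $B(s,t)=\Gamma(s)\Gamma(t)/\Gamma(s+t)$. For $f:\mathbb N^2\to\mathbb R$, $$\mathcal Lf(n,m)=\sum_{k=0}^n\sum_{l=0}^mr_{s,t}(n,m;k,l)\big(f(n-k+l,\;m-l+k)-f(n,m)\big),$$ $$r_{s,t}(n,m;k,l)=\frac{n!\,m!}{B(s,t)^2}\,\frac{\Gamma(k+s)\,\Gamma(m-l+t)\,\Gamma(n-k+t)\,\Gamma(l+s)}{\Gamma(s+t+n)\,\Gamma(s+t+m)\,(n-k)!\,k!\,(m-l)!\,l!}.$$ The operator $K^+$ acts on functions $f:\mathbb N\to\mathbb R$ by $K^+f(n)=(s+t+n)f(n+1)$; $K_1^+$ (resp. $K_2^+$) is $K^+$ acting on the first (resp. second) variable of a function on $\mathbb N^2$. *)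

(* Defs.v *)
From mathcomp Require Import all_boot all_order all_algebra.
From mathcomp Require Import all_classical all_reals all_analysis.

Set Implicit Arguments.
Unset Strict Implicit.
Unset Printing Implicit Defensive.

Import Order.TTheory GRing.Theory Num.Theory.
Import numFieldNormedType.Exports.

Local Open Scope ring_scope.

(* Euler's integral; it converges for z > 0, the only range used below. *)
Definition Gamma (R : realType) (z : R) : R :=
  \int[@lebesgue_measure R]_(x in `]0, +oo[%classic)
    (x `^ (z - 1) * expR (- x)).

Definition Beta (R : realType) (s t : R) : R :=
  Gamma s * Gamma t / Gamma (s + t).

(* The natural subtractions n - k and m - l below are only meaningful for
   k <= n and l <= m, which the summation ranges of [generator] ensure. *)
Definition rate (R : realType) (s t : R) (n m k l : nat) : R :=
  (n`!%:R * m`!%:R) / Beta s t ^+ 2 *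
  ((Gamma (k%:R + s) * Gamma ((m - l)%:R + t) *
    Gamma ((n - k)%:R + t) * Gamma (l%:R + s)) /
   (Gamma (s + t + n%:R) * Gamma (s + t + m%:R) *
    (n - k)`!%:R * k`!%:R * (m - l)`!%:R * l`!%:R)).

Definition generator (R : realType) (s t : R) (f : nat -> nat -> R)
    (n m : nat) : R :=
  \sum_(0 <= k < n.+1) \sum_(0 <= l < m.+1)
    rate s t n m k l * (f (n - k + l)%N (m - l + k)%N - f n m).

Definition Kplus (R : realType) (s t : R) (g : nat -> R) (n : nat) : R :=
  (s + t + n%:R) * g n.+1.

Definition Kplus1 (R : realType) (s t : R) (f : nat -> nat -> R)
    (n m : nat) : R := Kplus s t (fun n' => f n' m) n.

Definition Kplus2 (R : realType) (s t : R) (f : nat -> nat -> R)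
    (n m : nat) : R := Kplus s t (fun m' => f n m') m.

Definition Kplus12 (R : realType) (s t : R) (f : nat -> nat -> R)
    (n m : nat) : R := Kplus1 s t f n m + Kplus2 s t f n m.

(* Main.v *)
(* The rates factor as a product of two beta-binomial weights, so
   that, up to a multiple of the identity, the generator is the operator
   averaging over the independent splittings [n = k + (n - k)] and
   [m = l + (m - l)] followed by the exchange of the parts [k] and [l].
   Since [Gamma (z + 1) = z * Gamma z], multiplying the weights of [n + 1] by
   [s + t + n] adds one particle to a splitting of [n]: to the part [i] with
   coefficient [s + i], to the other part [j] with coefficient [t + j].
   Applied to either variable this produces, after the exchange, the same
   coefficients as the operator K+ applied before it.  Taking a constant
   function shows that the total weight does not depend on [n], so the multiple
   of the identity is a true constant and commutes as well. *)

Require Import Defs.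
From mathcomp Require Import all_boot all_order all_algebra.
From mathcomp Require Import all_classical all_reals all_analysis.
From mathcomp Require Import measurable_realfun ring lra.

Set Implicit Arguments.
Unset Strict Implicit.
Unset Printing Implicit Defensive.
Import Order.TTheory GRing.Theory Num.Theory.
Import numFieldNormedType.Exports.

Local Open Scope classical_set_scope.
Local Open Scope ring_scope.

(** * Regularity and decay of the Gamma integrand *)

Lemma continuous_powRl (R : realType) (z x : R) : 0 < x ->
  {for x, continuous (fun y : R => y `^ z)}.
Proof.
move=> x0; apply: differentiable_continuous; apply/derivable1_diffP.
by apply: derivable_powR; rewrite in_itv/= andbT.
Qed.

(** From [1 + u <= expR u] at [u = x / (2 * z)] one gets [x <= 2 * z * expR (x / (2 * z))]; raising
    this to the power [z] costs only half of the exponential decay. *)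
Lemma powR_expRN_le (R : realType) (z x : R) : 0 < z -> 0 <= x ->
  x `^ z * expR (- x) <= (2 * z) `^ z * expR (- (x / 2)).
Proof.
move=> z0 x0; have c0 : 0 < 2 * z by lra.
have -> : expR (- (x / 2)) = expR (x / (2 * z)) `^ z * expR (- x).
  rewrite -expRM -expRD; congr expR; field.
  by rewrite gt_eqF.
rewrite mulrA ler_wpM2r ?expR_ge0// -powRM ?expR_ge0 ?(ltW c0)//.
apply: ge0_ler_powR; rewrite ?nnegrE ?(ltW z0)//.
  by rewrite mulr_ge0 ?expR_ge0// ltW.
rewrite -ler_pdivrMl// mulrC; apply: le_trans (expR_ge1Dx _).
by rewrite lerDr.
Qed.

Lemma powR_expRN_cvgy (R : realType) (z : R) : 0 < z ->
  (x `^ z * expR (- x)) @[x --> +oo] --> (0 : R).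
Proof.
move=> z0.
apply: (@squeeze_cvgr _ _ _ _ (cst 0) (fun x => (2 * z) `^ z * expR (- (x / 2)))).
- near=> x; rewrite mulr_ge0 ?powR_ge0 ?expR_ge0//=.
  apply: powR_expRN_le => //; near: x; apply: nbhs_pinfty_ge; exact: num_real.
- exact: cvg_cst.
- rewrite -[X in _ --> X](mulr0 ((2 * z) `^ z)); apply: cvgM; first exact: cvg_cst.
  apply: (cvg_comp (fun x : R => x / 2) (fun x => expR (- x))).
    apply: gt0_cvgMly => //; exact: cvg_id.
  exact: cvgr_expR.
Unshelve. all: end_near. Qed.

Lemma powR_expRN_cvg0 (R : realType) (z : R) : 0 < z ->
  (x `^ z * expR (- x)) @[x --> 0^'+] --> (0 : R).
Proof.
move=> z0.
apply: (@squeeze_cvgr _ _ _ _ (cst 0) (fun x : R => x `^ z)).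
- near=> x; rewrite mulr_ge0 ?powR_ge0 ?expR_ge0//=.
  by rewrite ler_piMr ?powR_ge0// expR_le1 oppr_le0.
- exact: cvg_cst.
- exact: powR_cvg0.
Unshelve. all: end_near. Qed.

(** * The functional equation of Gamma *)

Lemma Gamma_by_parts (R : realType) (z a b : R) : 0 < a -> a < b ->
  (\int[@lebesgue_measure R]_(x in `[a, b]) (x `^ z * expR (- x))%:E =
   (a `^ z * expR (- a) - b `^ z * expR (- b))%:E +
   z%:E * \int[@lebesgue_measure R]_(x in `[a, b])
            (x `^ (z - 1) * expR (- x))%:E)%E.
Proof.
move=> a0 ab.
have gt0 x : `[a, b]%classic x -> 0 < x.
  by rewrite /= in_itv/= => /andP[ax _]; exact: lt_le_trans ax.
have cE (x : R) : {for x, continuous (fun x : R => expR (- x))}.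
  by apply: continuous_comp; [exact: opp_continuous|exact: continuous_expR].
have dE (x : R) : is_derive x 1 (fun x : R => - expR (- x)) (expR (- x)).
  apply: is_derive_eq.
  by rewrite /GRing.scale/= mulrN1 opprK.
have LR (F : R -> R) : (forall x, 0 < x -> derivable F x 1) ->
    derivable_oo_LRcontinuous F a b.
  move=> dF; have cF x : 0 < x -> {for x, continuous F}.
    by move=> x0; apply/differentiable_continuous/derivable1_diffP/dF.
  split.
  - move=> x; rewrite in_itv/= => /andP[ax _]; apply: dF; exact: lt_trans ax.
  - by apply: cvg_at_right_filter; exact: cF.
  - by apply: cvg_at_left_filter; apply: cF; exact: lt_trans ab.
have c2 : {within `[a, b], continuous (fun x => x `^ (z - 1) * expR (- x))}.
  apply: continuous_in_subspaceT => x; rewrite inE => /gt0 x0.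
  by apply: cvgM; [exact: continuous_powRl|exact: cE].
have int1 : (@lebesgue_measure R).-integrable `[a, b]
    (fun x => (x `^ (z - 1) * expR (- x))%:E).
  apply: (@continuous_compact_integrable R
    (fun x => x `^ (z - 1) * expR (- x)) `[a, b]) => //.
  exact: segment_compact.
rewrite (@integration_by_parts _ (fun x => x `^ z) (fun x => - expR (- x))
  (fun x => z * x `^ (z - 1))) //.
- under [in LHS]eq_integral do rewrite mulrN -mulrA -mulNr EFinM.
  rewrite integralZl// EFinN mulNe oppeK; congr (_ + _)%E.
  by rewrite !mulrN opprK addrC.
- apply: continuous_in_subspaceT => x; rewrite inE => /gt0 x0.
  by apply: cvgM; [exact: cvg_cst|exact: continuous_powRl].
- by apply: LR => x x0; apply: derivable_powR; rewrite in_itv/= andbT.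
- move=> x; rewrite in_itv/= => /andP[ax _].
  by rewrite powR_derive1// in_itv/= andbT; exact: lt_trans ax.
- by apply: continuous_subspaceT => y; exact: cE.
- by apply: LR => x _; exact: ex_derive.
- by move=> x _; rewrite derive1E derive_val.
Qed.

(** Monotone convergence: the integrand is nonnegative and the segments increase to the
    half-line. *)
Lemma Gamma_integral_cvg (R : realType) (z : R) :
  (\int[@lebesgue_measure R]_(x in `[(n.+1%:R)^-1%R, n.+1%:R%R])
     (x `^ (z - 1) * expR (- x))%:E @[n --> \oo] -->
   \int[@lebesgue_measure R]_(x in `]0%R, +oo[)
     (x `^ (z - 1) * expR (- x))%:E)%E.
Proof.
have -> : `]0%R, +oo[%classic = \bigcup_n `[(n.+1%:R)^-1, n.+1%:R]%classic :> set R.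
  apply/seteqP; split=> x /=.
    rewrite in_itv/= andbT => x0.
    pose n := maxn (Num.truncn x) (Num.truncn x^-1).
    exists n => //=; rewrite in_itv/=; apply/andP; split.
      rewrite invf_ple ?posrE//.
      apply/ltW/(lt_le_trans (truncnS_gt _)).
      by rewrite ler_nat ltnS leq_maxr.
    apply/ltW/(lt_le_trans (truncnS_gt _)).
    by rewrite ler_nat ltnS leq_maxl.
  move=> [n _ /=]; rewrite !in_itv/= andbT => /andP[+ _].
  by apply: lt_le_trans; rewrite invr_gt0.
apply: ge0_nondecreasing_set_cvg_integral.
- move=> m n mn; apply/subsetPset => x/=; rewrite !in_itv/= => /andP[h1 h2].
  apply/andP; split.
    by apply: le_trans h1; rewrite lef_pV2 ?posrE// ler_nat.
  by apply: le_trans h2 _; rewrite ler_nat.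
- by move=> n; exact: measurable_itv.
- move=> n; apply/measurable_EFinP; apply: measurable_funTS.
  apply: measurable_funM; first exact: measurable_powR.
  by apply: measurableT_comp => //; exact: measurable_oppr.
- by move=> n x _; rewrite lee_fin mulr_ge0 ?powR_ge0 ?expR_ge0.
Qed.

Lemma GammaS (R : realType) (z : R) : 0 < z -> Gamma (z + 1) = z * Gamma z.
Proof.
move=> z0; rewrite /Gamma /Rintegral.
set J := fun y : R => (\int[@lebesgue_measure R]_(x in `]0%R, +oo[)
     (x `^ (y - 1) * expR (- x))%:E)%E.
(* Passing to the limit in \bar R makes integrability of the two integrands
   irrelevant: [fine] sends an infinite value to 0 on both sides. *)
suff -> : (\int[@lebesgue_measure R]_(x in `]0%R, +oo[)
     (x `^ (z + 1 - 1) * expR (- x))%:E = z%:E * J z)%E.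
  rewrite /J; case: (X in (z%:E * X)%E) => [r||] //=.
  - by rewrite gt0_muley ?lte_fin//= mulr0.
  - by rewrite gt0_muleNy ?lte_fin//= mulr0.
(* Both sides are limits of the same truncated integrals. *)
apply: (cvg_unique _ (@Gamma_integral_cvg R (z + 1))) => //.
rewrite addrK.
have nV : ((n.+1%:R : R)^-1 @[n --> \oo] --> (0 : R))%R by exact: cvg_harmonic.
have nI : ((n.+1%:R : R) @[n --> \oo] --> +oo)%R.
  by rewrite (cvg_shiftS (fun n => n%:R : R)); exact: cvgr_idn.
(* The added 0 is the limit of the boundary terms. *)
rewrite -(add0e (z%:E * J z)%E).
apply: (@cvg_trans _ ((((n.+1%:R^-1 : R) `^ z * expR (- n.+1%:R^-1) -
       n.+1%:R `^ z * expR (- n.+1%:R))%:E +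
   z%:E * \int[@lebesgue_measure R]_(x in `[n.+1%:R^-1%R, n.+1%:R%R])
            (x `^ (z - 1) * expR (- x))%:E)%E @[n --> \oo])).
  apply: near_eq_cvg; near=> n; rewrite -Gamma_by_parts//.
  (* At [n = 0] the segment is a single point, so [n > 0] is required. *)
  have n1 : 1 < n.+1%:R :> R by rewrite ltr1n ltnS; near: n; exact: nbhs_infty_gt.
  apply: lt_trans (n1); rewrite invf_lt1 ?ltr0Sn//; exact: n1.
apply: cvgeD.
- by rewrite fin_num_adde_defr.
- apply: cvg_EFin; first by near=> n.
  rewrite -(subr0 (0 : R)); apply: cvgB.
    by move/cvg_at_rightP: (powR_expRN_cvg0 z0); apply; split.
  exact: (cvg_comp _ _ nI (powR_expRN_cvgy z0)).
- by apply: cvgeZl => //; exact: Gamma_integral_cvg.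
Unshelve. all: end_near. Qed.

(** * Beta-binomial splittings *)

(* The beta-binomial probability of splitting [n] into [k] and [n - k]; its sum
   over [k] is never evaluated, only shown to be independent of [n]. *)
Definition split_weight (R : realType) (s t : R) (n k : nat) : R :=
  n`!%:R * Gamma (k%:R + s) * Gamma ((n - k)%:R + t) /
  (Gamma (s + t + n%:R) * (n - k)`!%:R * k`!%:R * Beta s t).

Definition split_sum (R : realType) (s t : R) (n : nat) (g : nat -> nat -> R) : R :=
  \sum_(0 <= k < n.+1) split_weight s t n k * g k (n - k)%N.

Lemma rate_split (R : realType) (s t : R) n m k l :
  rate s t n m k l = split_weight s t n k * split_weight s t m l.
Proof. by rewrite /rate /split_weight expr2 !invfM; ring. Qed.

(** On the left a factor [n.+1] appears; it is split as [k + (n.+1 - k)]. Each half, absorbed into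
    the factorials, is the addition of a particle to one of the two parts. *)
Lemma split_sumS (R : realType) (s t : R) (n : nat) (g : nat -> nat -> R) :
  0 < s -> 0 < t ->
  (s + t + n%:R) * split_sum s t n.+1 g =
  split_sum s t n (fun i j => (s + i%:R) * g i.+1 j + (t + j%:R) * g i j.+1).
Proof.
move=> s0 t0; rewrite /split_sum.
(* [split_weight s t n k] is [c * u k (n - k)], with [c] free of [k]. *)
pose c : R := n`!%:R / (Gamma (s + t + n%:R) * Beta s t).
pose u i j : R := Gamma (i%:R + s) * Gamma (j%:R + t) / (j`!%:R * i`!%:R).
have f0 k : k`!%:R != 0 :> R by rewrite pnatr_eq0 -lt0n fact_gt0.
have GS k (x : R) : 0 < x -> Gamma (k.+1%:R + x) = (k%:R + x) * Gamma (k%:R + x).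
  move=> x0; rewrite -GammaS; last by rewrite ltr_wpDl.
  by congr Gamma; rewrite -natr1; ring.
have cS : (s + t + n%:R) * (n.+1`!%:R / (Gamma (s + t + n.+1%:R) * Beta s t))
          = n.+1%:R * c.
  rewrite addrC (addrC (s + t) n.+1%:R) GS; last exact: addr_gt0.
  have h : n%:R + (s + t) != 0 by rewrite gt_eqF// ltr_wpDl// addr_gt0.
  (* [Beta] is generalized because [invfM] would unfold it. *)
  rewrite /c [s + t + _]addrC; move: (Beta s t) (Gamma (n%:R + (s + t))) => B G.
  transitivity ((n%:R + (s + t)) / (n%:R + (s + t)) * (n.+1%:R * (n`!%:R / (G * B)))).
    by rewrite factS natrM !invfM; ring.
  by rewrite mulfV// mul1r.
have L : (s + t + n%:R) * \sum_(0 <= k < n.+2)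
      split_weight s t n.+1 k * g k (n.+1 - k)%N =
    c * \sum_(0 <= k < n.+2) n.+1%:R * u k (n.+1 - k)%N * g k (n.+1 - k)%N.
  rewrite !mulr_sumr; apply: eq_bigr => k _.
  rewrite [RHS](_ : _ = (n.+1%:R * c) * u k (n.+1 - k)%N * g k (n.+1 - k)%N); last by ring.
  rewrite -cS /split_weight /u; move: (Beta s t) (Gamma (s + t + _)) => B G.
  by rewrite !invfM; ring.
rewrite L.
have RH : \sum_(0 <= k < n.+1) split_weight s t n k *
    ((s + k%:R) * g k.+1 (n - k)%N + (t + (n - k)%:R) * g k (n - k).+1) =
  c * (\sum_(0 <= k < n.+1) k.+1%:R * u k.+1 (n - k)%N * g k.+1 (n - k)%N +
       \sum_(0 <= k < n.+1) (n.+1 - k)%:R * u k (n.+1 - k)%N * g k (n.+1 - k)%N).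
  rewrite -big_split mulr_sumr; apply: eq_big_nat => k /andP[_ kn] /=.
  rewrite subSn// /split_weight /u !GS// !factS !natrM /c.
  move: (Beta s t) (Gamma (s + t + _)) => B G.
  rewrite !invfM; move: (B^-1) (G^-1) => B' G'; field.
  by rewrite !f0 ![1 + _]addrC !natr1 !pnatr_eq0.
rewrite RH; congr (_ * _).
(* Both sums are brought to the range of [n.+1]: here the new term [k = n.+1] vanishes, and after
   the shift of the other sum the term [k = 0] does. *)
rewrite (_ : \sum_(0 <= k < n.+1) (n.+1 - k)%:R * _ * _ =
  \sum_(0 <= k < n.+2) (n.+1 - k)%:R * u k (n.+1 - k)%N * g k (n.+1 - k)%N); last first.
  by rewrite [RHS]big_nat_recr//= subnn !mul0r addr0.
rewrite (_ : \sum_(0 <= k < n.+1) _ * _ * _ =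
  \sum_(0 <= k < n.+2) k%:R * u k (n.+1 - k)%N * g k (n.+1 - k)%N); last first.
  by rewrite [RHS]big_nat_recl//= !mul0r add0r.
rewrite -big_split; apply: eq_big_nat => k /andP[_ kn] /=.
by rewrite -!mulrDl -natrD subnKC.
Qed.

Definition split_mass (R : realType) (s t : R) n := split_sum s t n (fun _ _ => 1).

(** For a constant function the two coefficients in [split_sumS] add up to [s + t + n], which
    cancels. *)
Lemma split_massE (R : realType) (s t : R) (n : nat) : 0 < s -> 0 < t ->
  split_mass s t n = split_mass s t 0.
Proof.
move=> s0 t0; elim: n => // n <-.
have h : s + t + n%:R != 0 by apply: lt0r_neq0; apply: ltr_wpDr => //; exact: addr_gt0.
apply: (mulfI h); rewrite /split_mass split_sumS// /split_sum mulr_sumr.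
apply: eq_big_nat => k /andP[_ kn].
have -> : n%:R = k%:R + (n - k)%:R :> R by rewrite -natrD subnKC.
by ring.
Qed.

(** * The generator as an averaging operator *)

(* The part [i] of [n] and the part [k] of [m] are exchanged. *)
Definition averaging (R : realType) (s t : R) (f : nat -> nat -> R) n m : R :=
  split_sum s t n (fun i j => split_sum s t m (fun k l => f (j + k)%N (l + i)%N)).

(** The total jump rate is the product of the masses for [n] and [m], hence constant. *)
Lemma generatorE (R : realType) (s t : R) f n m : 0 < s -> 0 < t ->
  generator s t f n m = averaging s t f n m - split_mass s t 0 ^+ 2 * f n m.
Proof.
move=> s0 t0; rewrite expr2 -{1}(split_massE n s0 t0) -(split_massE m s0 t0).
rewrite /generator /averaging /split_mass /split_sum.
rewrite -mulrA [_ * f n m]mulr_suml [in RHS]mulr_suml -sumrB.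
apply: eq_bigr => k _; rewrite mulr1 -mulrBr -sumrB mulr_sumr.
by apply: eq_bigr => l _; rewrite rate_split mulr1 -mulrBr mulrA.
Qed.

Lemma eq_split_sum (R : realType) (s t : R) n g h :
  (forall i j, (i + j)%N = n -> g i j = h i j) ->
  split_sum s t n g = split_sum s t n h.
Proof.
move=> gh; apply: eq_big_nat => k /andP[_ kn]; rewrite gh//.
by rewrite subnKC.
Qed.

Lemma split_sumD (R : realType) (s t : R) n g h :
  split_sum s t n (fun i j => g i j + h i j) =
  split_sum s t n g + split_sum s t n h.
Proof.
by rewrite -big_split; apply: eq_bigr => k _; rewrite mulrDr.
Qed.

Lemma split_sumZ (R : realType) (s t : R) n a g :
  split_sum s t n (fun i j => a * g i j) = a * split_sum s t n g.
Proof. by rewrite mulr_sumr; apply: eq_bigr => k _; rewrite mulrCA. Qed.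

(** After the exchange, particles added to [j] or [k] raise the first variable with total
    coefficient [(t + j) + (s + k)], those added to [i] or [l] the second with [(s + i) + (t + l)]:
    the coefficients of K+ at [(j + k, l + i)]. *)
Lemma averaging_Kplus12 (R : realType) (s t : R) f n m : 0 < s -> 0 < t ->
  averaging s t (Kplus12 s t f) n m = Kplus12 s t (averaging s t f) n m.
Proof.
move=> s0 t0; rewrite /Kplus12 /Kplus1 /Kplus2 /Kplus /averaging.
rewrite split_sumS// -split_sumZ -split_sumD; apply: eq_split_sum => i j ijn.
rewrite split_sumS// -!split_sumZ -!split_sumD; apply: eq_split_sum => k l klm.
rewrite !addSn !addnS !natrD; ring.
Qed.

Theorem theorem6p1 (R : realType) (s t : R) (hs : 0 < s) (ht : 0 < t)
    (f : nat -> nat -> R) :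
  generator s t (Kplus12 s t f) = Kplus12 s t (generator s t f).
Proof.
apply/funext => n; apply/funext => m.
rewrite generatorE// averaging_Kplus12//.
rewrite /Kplus12 /Kplus1 /Kplus2 /Kplus !generatorE//; ring.
Qed.
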